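(* Let $G$ be a $k$-partially walk-regular graph with $n$ vertices, adjacency matrix $A$, and spectrum $\{\theta_0^{m_0},\ldots,\theta_d^{m_d}\}$, that is, with distinct eigenvalues $\theta_0>\theta_1>\cdots>\theta_d$ having multiplicities $m_0,m_1,\ldots,m_d$ respectively. Let $p_k\in\mathbb{R}_k[x]$ be a $k$-minor polynomial of $G$. Then, for every $k=0,\ldots,d-1$, the $k$-independence number $\alpha_k$ of $G$ satisfies $$\alpha_k\le \operatorname{tr} p_k(A)=\sum_{i=0}^d m_i\, p_k(\theta_i).$$
   Context: Graphs are finite and simple; the eigenvalues of a graph are those of its adjacency matrix. $\mathbb{R}_k[x]$ denotes the set of real polynomials of degree at most $k$. The $k$-independence number $\alpha_k=\alpha_k(G)$ is the maximum size of a set of vertices of $G$ such that any two distinct vertices in the set are at distance greater than $k$ in $G$. For an integer $k\ge 0$, a graph $G$ is $k$-partially walk-regular if the number of closed walks of a given length $l\le k$, rooted at a vertex $v$, depends only on $l$ (and not on $v$); equivalently, for each $0\le l\le k$ all diagonal entries of $A^l$ are equal. For a graph with adjacency matrix $A$ and distinct eigenvalues $\theta_0>\theta_1>\cdots>\theta_d$, and $0\le k\le d$, let $\mathcal{P}_k=\{p\in\mathbb{R}_k[x] : p(\theta_0)=1,\ p(\theta_i)\ge 0 \text{ for } 1\le i\le d\}$. A $k$-minor polynomial of $G$ is a polynomial $p_k\in\mathcal{P}_k$ such that $\operatorname{tr} p_k(A)=\min\{\operatorname{tr} p(A) : p\in\mathcal{P}_k\}$.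
   Formalization: For k = 1 the graph is additionally assumed regular: every simple graph is 1-partially walk-regular, and the star K_{1,3} violates the bound (α_1 = 3, tr p_1(A) = 2). For k ≥ 2 regularity follows from walk-regularity; for k = 0 it is not needed. *)

(* Defs.v *)
From mathcomp Require Import all_boot all_order all_algebra.
From mathcomp Require Import reals.

Set Implicit Arguments.
Unset Strict Implicit.
Unset Printing Implicit Defensive.

Import Order.TTheory GRing.Theory Num.Theory.

Section Graph.
Variables (T : finType) (e : rel T).

Definition simple_graph : Prop := symmetric e /\ irreflexive e.

(* Every simple graph is 1-partially walk-regular, so the case k = 1 of the
   trace bound on k-independence numbers, the ratio bound, needs regularity
   separately: for K_(1,3) the 1-minor polynomial is (x + t) / (2 t) with
   t = sqrt 3, of trace 2, but there are 3 independent vertices. *)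
Definition regular : Prop :=
  exists r, forall v, #|[set w | e v w]| = r.

(* The walk u, p_0, ..., p_(l-1) is represented by the tuple p of the
   vertices that follow its initial vertex u. *)
Definition walks (l : nat) (u v : T) : {set l.-tuple T} :=
  [set p : l.-tuple T | path e u p && (last u p == v)].

Definition partially_walk_regular (k : nat) : Prop :=
  forall l, (l <= k)%N -> forall u v, #|walks l u u| = #|walks l v v|.

(* A shortest walk has fewer than #|T| edges, so the search may stop there;
   None is the infinite distance between vertices in different components. *)
Definition dist (u v : T) : option nat :=
  let l := find (fun l => walks l u v != set0) (iota 0 #|T|) in
  if (l < #|T|)%N then Some l else None.

Definition dist_gt (k : nat) (u v : T) : bool :=
  if dist u v is Some l then (k < l)%N else true.

Lemma dist_gtP k u v :
  reflect (forall p, path e u p -> last u p = v -> (k < size p)%N)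
          (dist_gt k u v).
Proof.
have short p : path e u p -> last u p = v ->
    exists2 l, (l < #|T|)%N && (l <= size p)%N & walks l u v != set0.
  move=> + <-; case/shortenP=> q eq uq sub.
  exists (size q).
    have := max_card (mem (u :: q)); rewrite (card_uniqP uq) => -> /=.
    by case/andP: uq => _ uq; apply: uniq_leq_size.
  by apply/set0Pn; exists (in_tuple q); rewrite inE eq eqxx.
rewrite /dist_gt /dist; set P := fun l => _.
case: ifPn => [lt_l|ge_l]; last first.
  constructor=> p pe pv; have [l /andP[ln _] Pl] := short p pe pv.
  move: ge_l; rewrite -[X in (_ < X)%N](size_iota 0) -has_find => /hasPn/(_ l).
  by rewrite mem_iota ln /P Pl => /(_ isT).
set l := find _ _ in lt_l *.
have Pl : P l.
  have := nth_find 0%N (_ : has P (iota 0 #|T|)).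
  by rewrite has_find size_iota nth_iota // => /(_ lt_l).
apply: (iffP idP) => [kl p pe pv|H].
  have [j /andP[jn jp] Pj] := short p pe pv.
  apply: leq_trans kl (leq_trans _ jp); rewrite leqNgt; apply/negP => jl.
  by have := before_find 0%N jl; rewrite nth_iota // /P Pj.
have /set0Pn[p] := Pl; rewrite inE => /andP[pe /eqP pv].
by have := H p pe pv; rewrite size_tuple.
Qed.

Definition k_independent (k : nat) (S : {set T}) : bool :=
  [forall u in S, forall v in S, (u != v) ==> dist_gt k u v].

Definition k_independence_number (k : nat) : nat :=
  \max_(S : {set T} | k_independent k S) #|S|.

End Graph.

Local Open Scope ring_scope.

Section Spectrum.
Variable R : realType.

Definition adjacency (n : nat) (e : rel 'I_n) : 'M[R]_n :=
  \matrix_(i, j) (e i j)%:R.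

Definition has_spectrum (n : nat) (A : 'M[R]_n) (d : nat)
    (theta : 'I_d.+1 -> R) (m : 'I_d.+1 -> nat) : Prop :=
  [/\ forall i j : 'I_d.+1, (i < j)%N -> theta j < theta i,
      forall a : R, eigenvalue A a <-> exists i, a = theta i &
      forall i, m i = mup (theta i) (char_poly A)].

Definition minor_feasible (d : nat) (theta : 'I_d.+1 -> R) (k : nat)
    (p : {poly R}) : Prop :=
  [/\ (size p <= k.+1)%N,
      p.[theta ord0] = 1 &
      forall i, i != ord0 -> 0 <= p.[theta i]].

(* horner_mx requires a matrix of positive size. *)
Definition minor_polynomial (n : nat) (A : 'M[R]_n.+1) (d : nat)
    (theta : 'I_d.+1 -> R) (k : nat) (p : {poly R}) : Prop :=
  minor_feasible theta k p /\
  forall q, minor_feasible theta k q ->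
    \tr (horner_mx A p) <= \tr (horner_mx A q).

End Spectrum.

(* Main.v *)
Require Import Defs.
From mathcomp Require Import all_boot all_order all_algebra.
From mathcomp Require Import reals.
From mathcomp Require Import complex.
Import Order.TTheory GRing.Theory Num.Theory.
Local Open Scope ring_scope.

(** Write A for the adjacency matrix, p for the minor polynomial, N for the
number of vertices, and B = p(A).  Thus p has
degree at most k, p(theta_0) = 1, and p is nonnegative on the spectrum.

Each hypothesis turns into a property of B.  Since p is nonnegative on the
spectrum of the symmetric matrix A, B is positive semidefinite
([symmetric_spectrum]).  The (u, v) entry of B is a combination of the numbers
of walks of length at most k from u to v ([horner_adjacency]); hence B has a
constant diagonal, equal to tr B / N, by k-partial walk-regularity, and vanishes
off the diagonal on a k-independent set S.  Finally, if G is regular then its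
degree is theta_0, with the all-ones vector j as eigenvector
([regular_largest_eigenvalue]), so that B fixes j.

Now let x be the indicator vector of S.  On one side x B x^T = |S| tr B / N.  On
the other side, x has component (|S| / N) j along j, and a positive semidefinite
symmetric matrix that fixes j satisfies x B x^T >= |S|^2 / N
([psd_fixed_const]).  Comparing, |S| <= tr B ([zero_block_trace_bound]).

Regularity is a hypothesis for k = 1, and for k >= 2 it follows from the closed
walks of length 2, which are counted by the degree.  For k = 0 the polynomial p
is the constant 1, so that tr B = N, which bounds the size of any set.

The formula for tr B holds because A is diagonalizable: tr B is the sum of p over
the roots of the characteristic polynomial, and grouping equal roots produces
the multiplicities ([sum_over_roots]). *)

(** * Spectrum of a real symmetric matrix *)

Lemma similar_char_poly (F : fieldType) (n : nat) (P A : 'M[F]_n) :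
  P \in unitmx -> char_poly (invmx P *m A *m P) = char_poly A.
Proof.
move=> Pu; rewrite /char_poly /char_poly_mx !map_mxM /=.
set Q := map_mx polyC P; set Q' := map_mx polyC (invmx P).
have QQ : Q' *m Q = 1%:M by rewrite -map_mxM mulVmx // map_mx1.
have -> : 'X%:M - Q' *m map_mx polyC A *m Q
    = Q' *m ('X%:M - map_mx polyC A) *m Q.
  by rewrite mulmxBr mulmxBl scalar_mxC -[_%:M *m _ *m _]mulmxA QQ mulmx1.
by rewrite !det_mulmx mulrAC -det_mulmx QQ det1 mul1r.
Qed.

Lemma char_poly_diag (R : comNzRingType) (n : nat) (v : 'rV[R]_n) :
  char_poly (diag_mx v) = \prod_i ('X - (v 0 i)%:P).
Proof.
rewrite char_poly_trig ?diag_mx_is_trig //.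
by apply: eq_bigr => i _; rewrite mxE eqxx.
Qed.

(** The spectral theorem is applied over the complex numbers; the three lemmas of
this section bring what it says back to the base field. *)
Section DiagonalizableOverExtension.
Variables (F K : fieldType) (f : {rmorphism F -> K}) (n : nat).
Variables (A : 'M[F]_n.+1) (P : 'M[K]_n.+1) (lam : 'rV[F]_n.+1).
Hypothesis Pu : P \in unitmx.
Hypothesis diagA : map_mx f A = invmx P *m diag_mx (map_mx f lam) *m P.

Lemma diagonalized_char_poly : char_poly A = \prod_i ('X - (lam 0 i)%:P).
Proof.
apply: (map_poly_inj f); rewrite map_char_poly diagA similar_char_poly //.
rewrite char_poly_diag rmorph_prod.
by apply: eq_bigr => i _; rewrite mxE /= map_polyXsubC.
Qed.

Lemma diagonalized_horner p : map_mx f (horner_mx A p)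
  = invmx P *m diag_mx (map_mx (fun a => f p.[a]) lam) *m P.
Proof.
rewrite map_horner_mx diagA horner_mx_uconjC // horner_mx_diag -map_mx_comp.
by congr (_ *m diag_mx _ *m _); apply/rowP => j; rewrite !mxE /= horner_map.
Qed.

Lemma diagonalized_trace p : \tr (horner_mx A p) = \sum_i p.[lam 0 i].
Proof.
apply: (fmorph_inj f); rewrite -trace_map_mx diagonalized_horner mxtrace_mulC.
rewrite mulmxA mulmxV // mul1mx mxtrace_diag rmorph_sum.
by apply: eq_bigr => i _; rewrite mxE.
Qed.

End DiagonalizableOverExtension.

Section SymmetricMatrix.
Local Open Scope complex_scope.
Variables (R : rcfType) (n : nat) (A : 'M[R]_n.+1).
Hypothesis symA : A^T = A.

Local Notation toC := (real_complex R).

(** Seen as a complex matrix, A is Hermitian, so that its spectral diagonal is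
real. *)
Lemma symmetric_spectral : exists (P : 'M[R[i]]_n.+1) (lam : 'rV[R]_n.+1),
  P \is unitarymx /\ map_mx toC A = invmx P *m diag_mx (map_mx toC lam) *m P.
Proof.
have herm : map_mx toC A \is hermsymmx.
  apply: realsym_hermsym; last first.
    by apply/mxOverP => i j; rewrite mxE complex_real.
  apply/is_hermitianmxP; rewrite expr0 scale1r map_mx_id //.
  by rewrite map_trmx symA.
have /mxOverP real_diag := hermitian_spectral_diag_real herm.
exists (spectralmx (map_mx toC A)).
exists (map_mx (@complex.Re R) (spectral_diag (map_mx toC A))).
split; first exact: spectral_unitarymx.
rewrite -map_mx_comp [X in diag_mx X](_ : _ = spectral_diag (map_mx toC A)).
  exact/orthomx_spectralP/hermitian_normalmx.
by apply/rowP => j; rewrite mxE /= RRe_real.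
Qed.

(** The third item comes from writing p(A) = P^-1 D P with P unitary: the form
x p(A) x^T becomes the sum of the D_i |y_i|^2 for y = x P^-1, where D_i is the
value of p at the i-th eigenvalue. *)
Lemma symmetric_spectrum : exists lam : 'I_n.+1 -> R,
  [/\ char_poly A = \prod_i ('X - (lam i)%:P),
      forall p, \tr (horner_mx A p) = \sum_i p.[lam i] &
      forall p, (forall i, 0 <= p.[lam i]) ->
        forall x : 'rV_n.+1, 0 <= (x *m horner_mx A p *m x^T) 0 0].
Proof.
have [P [lam [Punitary lamE]]] := symmetric_spectral.
have Pu := unitarymx_unit Punitary.
exists (fun i => lam 0 i); split=> [|p|p p_ge0 x].
- exact: diagonalized_char_poly Pu lamE.
- exact: diagonalized_trace Pu lamE p.
rewrite -ler0c.
have -> : toC ((x *m horner_mx A p *m x^T) 0 0)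
    = map_mx toC (x *m horner_mx A p *m x^T) 0 0 by rewrite [RHS]mxE.
rewrite !map_mxM (diagonalized_horner _ _ _ _ _ _ _ Pu lamE) invmx_unitary //.
rewrite !mulmxA.
set y := map_mx toC x *m _.
have yE : map_mx Num.conj y^T = P *m map_mx toC x^T.
  rewrite trmx_mul map_mxM map_trmx trmxK -map_mx_comp (map_mx_id (@conjCK _)).
  congr (_ *m _); apply/matrixP => i j; rewrite !mxE /=.
  by apply/CrealP; rewrite complex_real.
rewrite -mulmxA -yE mxE; apply: sumr_ge0 => j _.
rewrite mul_mx_diag !mxE mulrAC mulr_ge0 ?mul_conjC_ge0 //.
by rewrite ler0c.
Qed.

End SymmetricMatrix.

(** Grouping the indices i by the value of [lam i] turns a sum over the roots of a
split polynomial into a sum weighted by multiplicities. *)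
Lemma sum_over_roots (F : fieldType) (N d : nat) (lam : 'I_N -> F)
    (theta : 'I_d -> F) (g : F -> F) :
  injective theta -> (forall i, exists j, lam i = theta j) ->
  \sum_i g (lam i)
    = \sum_j (mup (theta j) (\prod_i ('X - (lam i)%:P)))%:R * g (theta j).
Proof.
move=> theta_inj lam_theta.
have mupE j : mup (theta j) (\prod_i ('X - (lam i)%:P))
    = (\sum_(i < N) (lam i == theta j))%N.
  rewrite -[X in mup _ X](big_map lam xpredT (fun a => 'X - a%:P)).
  by rewrite mu_prod_XsubC -sum1_count big_map big_mkcond.
under [RHS]eq_bigr => j _ do rewrite mupE natr_sum mulr_suml.
rewrite exchange_big; apply: eq_bigr => i _.
have [j lam_j] := lam_theta i.
rewrite (bigD1 j) //= lam_j eqxx mul1r big1 ?addr0 // => l lj.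
by rewrite (inj_eq theta_inj) eq_sym (negPf lj) mul0r.
Qed.

(** * Walks and powers of the adjacency matrix *)

Section Walks.
Variables (T : finType) (e : rel T).

Lemma card_walks0 u v : #|walks e 0 u v| = (u == v).
Proof.
have -> : walks e 0 u v = if u == v then setT else set0.
  by apply/setP => p; rewrite inE tuple0 /=; case: eqP; rewrite inE.
by case: eqP => _; rewrite ?cards0 // cardsT card_tuple expn0.
Qed.

(** Splitting off the first step of a walk is the recursion of matrix powers,
A^(l+1) = A A^l. *)
Lemma card_walksS l u v :
  #|walks e l.+1 u v| = (\sum_w e u w * #|walks e l w v|)%N.
Proof.
rewrite -sum1_card (eq_bigl _ _ (fun p => in_set _ p)).
pose f (wq : T * l.-tuple T) := [tuple of wq.1 :: wq.2].
pose g (p : l.+1.-tuple T) := (thead p, [tuple of behead p]).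
rewrite (reindex f) /=; last first.
  exists g => [[w q] _|p _].
    by rewrite /g /f theadE; congr pair; apply: val_inj.
  by rewrite /g /f /= [RHS]tuple_eta; apply: val_inj.
under eq_bigl => wq do rewrite -andbA.
rewrite -(pair_big_dep (e u)
  (fun w (q : l.-tuple T) => path e w q && (last w q == v)) (fun _ _ => 1%N)) /=.
rewrite big_mkcond; apply: eq_bigr => w _.
case: (e u w); rewrite ?mul0n // mul1n -sum1_card.
by apply: eq_bigl => q; rewrite inE.
Qed.

Lemma walks_dist_gt k l u v : dist_gt e k u v -> (l <= k)%N -> walks e l u v = set0.
Proof.
move=> /dist_gtP far lk; apply/setP => p; rewrite !inE.
apply/negP => /andP[pe /eqP pv].
by have := far p pe pv; rewrite size_tuple ltnNge lk.
Qed.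

End Walks.

Section Adjacency.
Variables (R : realType) (n : nat) (e : rel 'I_n.+1).
Local Notation A := (adjacency R e).

Lemma adjacency_sym : symmetric e -> A^T = A.
Proof. by move=> sym; apply/matrixP => i j; rewrite !mxE sym. Qed.

Lemma adjacencyX l u v : (A ^+ l) u v = #|walks e l u v|%:R.
Proof.
elim: l u => [|l IHl] u; first by rewrite expr0 mxE card_walks0.
rewrite exprS mxE card_walksS natr_sum; apply: eq_bigr => w _.
by rewrite IHl mxE natrM.
Qed.

Lemma horner_adjacency p u v :
  horner_mx A p u v = \sum_(l < size p) p`_l * #|walks e l u v|%:R.
Proof.
rewrite -{1}[p]coefK poly_def rmorph_sum summxE; apply: eq_bigr => l _.
by rewrite /= horner_mxZ rmorphXn /= horner_mx_X mxE adjacencyX.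
Qed.

(** A closed walk of length 2 at v is an edge at v followed back and forth, so
there are as many as the degree of v. *)
Lemma walk_regular_regular k : symmetric e -> partially_walk_regular e k ->
  (1 < k)%N -> regular e.
Proof.
move=> sym wr k_gt1; exists #|walks e 2 ord0 ord0| => v.
rewrite (wr 2 k_gt1 ord0 v).
suff closed2 : #|walks e 2 v v| = #|[set w | e v w]| by [].
rewrite card_walksS -sum1_card [RHS]big_mkcond; apply: eq_bigr => w _.
rewrite card_walksS (bigD1 v) //= card_walks0 eqxx muln1 big1 => [|z /negPf zv].
  by rewrite inE addn0 [e w v]sym; case: (e v w).
by rewrite card_walks0 zv muln0.
Qed.

Lemma horner_diag_const k (p : {poly R}) u v : partially_walk_regular e k ->
  (size p <= k.+1)%N -> horner_mx A p u u = horner_mx A p v v.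
Proof.
move=> wr sz; rewrite !horner_adjacency; apply: eq_bigr => l _.
by rewrite (wr l _ u v) // -ltnS (leq_trans _ sz).
Qed.

Lemma horner_far k (p : {poly R}) u v : dist_gt e k u v -> (size p <= k.+1)%N ->
  horner_mx A p u v = 0.
Proof.
move=> far sz; rewrite horner_adjacency big1 // => l _.
by rewrite (walks_dist_gt _ _ k) ?cards0 ?mulr0 // -ltnS (leq_trans _ sz).
Qed.

Lemma regular_eigenvector r : symmetric e -> (forall v, #|[set w | e v w]| = r) ->
  const_mx 1 *m A = r%:R *: const_mx 1 :> 'rV_n.+1.
Proof.
move=> sym deg; apply/rowP => j; rewrite !mxE mulr1 -(deg j).
rewrite -sum1_card natr_sum [RHS]big_mkcond; apply: eq_bigr => i _.
by rewrite !mxE mul1r inE sym; case: (e j i).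
Qed.

(** At an entry i of maximal modulus of an eigenvector x, the equation
a x_i = sum of the x_j over the r neighbours j of i gives |a| |x_i| <= r |x_i|. *)
Lemma eigenvalue_le_degree r a : (forall v, #|[set w | e v w]| = r) ->
  symmetric e -> eigenvalue A a -> a <= r%:R.
Proof.
move=> deg sym /eigenvalueP[x xA x0].
pose i := [arg max_(i > ord0) `|x 0 i|]%O.
have max_i j : `|x 0 j| <= `|x 0 i|.
  by rewrite /i; case: Order.TotalTheory.arg_maxP => //= m _; apply.
have xi_gt0 : 0 < `|x 0 i|.
  rewrite normr_gt0; apply: contraNneq x0 => xi0.
  apply/eqP/rowP => j; rewrite mxE; apply/eqP.
  by rewrite -normr_le0 (le_trans (max_i j)) // xi0 normr0.
rewrite -(ler_pM2r xi_gt0); apply: le_trans (_ : `|a * x 0 i| <= _).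
  by rewrite normrM ler_wpM2r ?ler_norm // ltW.
have -> : a * x 0 i = \sum_j x 0 j * A j i.
  by have /rowP/(_ i) := xA; rewrite !mxE => <-.
apply: le_trans (ler_norm_sum _ _ _) _.
rewrite -(deg i) -sum1_card natr_sum mulr_suml [leRHS]big_mkcond.
apply: ler_sum => j _; rewrite !mxE inE sym.
by case: (e i j); rewrite ?mulr1 ?mul1r // mulr0 normr0.
Qed.

End Adjacency.

(** The degree is an eigenvalue, for the all-ones vector, and bounds every
eigenvalue, so it is the largest one, theta_0. *)
Lemma regular_largest_eigenvalue (R : realType) n (e : rel 'I_n.+1) d
    (theta : 'I_d.+1 -> R) m :
  symmetric e -> has_spectrum (adjacency R e) theta m -> regular e ->
  const_mx 1 *m adjacency R e = theta ord0 *: const_mx 1 :> 'rV_n.+1.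
Proof.
move=> sym [decr eig _] [r deg].
have eigr := regular_eigenvector R _ _ _ sym deg.
suff -> : theta ord0 = r%:R by [].
apply/eqP; rewrite eq_le; apply/andP; split.
  by apply: eigenvalue_le_degree deg sym _; apply/eig; exists ord0.
have /eig[i ->] : eigenvalue (adjacency R e) r%:R.
  apply/eigenvalueP; exists (const_mx 1); first exact: eigr.
  by apply/eqP => /rowP/(_ ord0)/eqP; rewrite !mxE oner_eq0.
have [->//|i0] := eqVneq i ord0.
by rewrite ltW // decr // lt0n.
Qed.

(** * Positive semidefinite matrices that fix the all-ones vector *)

Lemma horner_eigenvector (F : fieldType) n (A : 'M[F]_n.+1) (x : 'rV_n.+1) a p :
  x *m A = a *: x -> x *m horner_mx A p = p.[a] *: x.
Proof.
move=> xA; elim/poly_ind: p => [|p c IHp].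
  by rewrite rmorph0 mulmx0 horner0 scale0r.
rewrite rmorphD rmorphM /= horner_mx_X horner_mx_C mulmxDr mulmxA IHp.
by rewrite -scalemxAl xA scalerA mul_mx_scalar !hornerE scalerDl.
Qed.

Lemma trmx_horner (R : comNzRingType) n (A : 'M[R]_n.+1) p :
  (horner_mx A p)^T = horner_mx A^T p.
Proof.
elim/poly_ind: p => [|p c IHp]; first by rewrite !rmorph0 trmx0.
rewrite !rmorphD !rmorphM /= !horner_mx_X !horner_mx_C linearD /= tr_scalar_mx.
by rewrite trmx_mul IHp; congr (_ + _); apply: comm_mx_horner.
Qed.

(** With j the all-ones vector, s the sum of the entries of x and N the
dimension, x - (s / N) j is orthogonal to j.  As B fixes j, the form of B at this
vector is x B x^T - s^2 / N. *)
Lemma psd_fixed_const (R : realFieldType) n (B : 'M[R]_n.+1) (x : 'rV_n.+1) :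
  B^T = B -> const_mx 1 *m B = const_mx 1 :> 'rV_n.+1 ->
  (forall y : 'rV_n.+1, 0 <= (y *m B *m y^T) 0 0) ->
  (\sum_i x 0 i) ^+ 2 <= n.+1%:R * (x *m B *m x^T) 0 0.
Proof.
move=> symB fixB psdB; pose s := \sum_i x 0 i; pose c := s / n.+1%:R.
pose one : 'rV[R]_n.+1 := const_mx 1.
have N_gt0 : 0 < n.+1%:R :> R by rewrite ltr0Sn.
have Bone : B *m one^T = one^T by rewrite -{1}symB -trmx_mul fixB.
have sumE : (x *m one^T) 0 0 = s.
  by rewrite mxE; apply: eq_bigr => i _; rewrite !mxE mulr1.
have sumE' : (one *m x^T) 0 0 = s.
  by rewrite mxE; apply: eq_bigr => i _; rewrite !mxE mul1r.
have oneE : (one *m one^T) 0 0 = n.+1%:R.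
  rewrite mxE (eq_bigr (fun=> 1)) => [|i _]; last by rewrite !mxE mulr1.
  by rewrite sumr_const card_ord.
have psd_centred := psdB (x - c *: one).
have trE : (x - c *: one)^T = x^T - c *: one^T by rewrite linearB linearZ.
have qE : (x - c *: one) *m B *m (x - c *: one)^T
    = x *m B *m x^T - c *: (x *m one^T) - c *: (one *m x^T)
      + c ^+ 2 *: (one *m one^T).
  rewrite trE !mulmxBl !mulmxBr -!scalemxAl -!scalemxAr -[x *m B *m one^T]mulmxA.
  by rewrite Bone fixB -/one scalerA -expr2 opprB addrA addrAC.
have cN : c * n.+1%:R = s by rewrite divfK ?gt_eqF.
rewrite qE in psd_centred; move: sumE sumE' oneE psd_centred.
(* Generalizing the four products keeps [mxE] from expanding them into sums. *)
move: (x *m B *m x^T) (x *m one^T) (one *m x^T) (one *m one^T) => X Y Z W.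
rewrite !mxE => -> -> ->; rewrite expr2 -mulrA cN subrK subr_ge0 => cs_le.
by rewrite -/s expr2 -{1}cN mulrAC [leLHS]mulrC ler_pM2l.
Qed.

(** Evaluated at the indicator vector of S, the form of B only sees the diagonal:
it is |S| b, whereas [psd_fixed_const] bounds it below by |S|^2 / N, and
tr B = N b. *)
Lemma zero_block_trace_bound (R : realFieldType) n (B : 'M[R]_n.+1) b
    (S : {set 'I_n.+1}) :
  B^T = B -> const_mx 1 *m B = const_mx 1 :> 'rV_n.+1 ->
  (forall y : 'rV_n.+1, 0 <= (y *m B *m y^T) 0 0) ->
  (forall i, B i i = b) ->
  (forall i j, i \in S -> j \in S -> i != j -> B i j = 0) ->
  #|S|%:R <= \tr B.
Proof.
move=> symB fixB psdB diagB offB.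
have trB : \tr B = n.+1%:R * b.
  rewrite /mxtrace (eq_bigr (fun=> b)) => [|i _]; last exact: diagB.
  by rewrite sumr_const card_ord mulr_natl.
have b_ge0 : 0 <= b.
  have := psdB (delta_mx 0 ord0).
  by rewrite -rowE trmx_delta -colE !mxE diagB.
have [->|S_gt0] := posnP #|S|; first by rewrite trB mulr_ge0.
pose x : 'rV[R]_n.+1 := \row_i (i \in S)%:R.
have sum_x : \sum_i x 0 i = #|S|%:R.
  rewrite -sum1_card natr_sum [RHS]big_mkcond; apply: eq_bigr => i _.
  by rewrite mxE; case: (i \in S).
have quad_x : (x *m B *m x^T) 0 0 = #|S|%:R * b.
  rewrite -sum_x mulr_suml mxE; apply: eq_bigr => j _.
  rewrite !mxE; case: (boolP (j \in S)) => jS; last by rewrite mulr0 mul0r.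
  rewrite mulr1 mul1r (bigD1 j) //= big1 => [|i ij].
    by rewrite mxE jS mul1r diagB addr0.
  by rewrite mxE; case: (boolP (i \in S)) => iS; rewrite ?mul0r // offB ?mulr0.
have := psd_fixed_const _ _ _ x symB fixB psdB.
by rewrite sum_x quad_x expr2 mulrCA -trB ler_pM2l ?ltr0n.
Qed.

(** * The trace bound *)

Theorem theorem4p1 (R : realType) (n : nat) (e : rel 'I_n.+1)
    (d : nat) (theta : 'I_d.+1 -> R) (m : 'I_d.+1 -> nat)
    (k : nat) (pk : {poly R})
    (he : simple_graph e)
    (hspec : has_spectrum (adjacency R e) theta m)
    (hk : (k < d)%N)
    (hwr : partially_walk_regular e k)
    (hreg : k = 1%N -> regular e)
    (hpk : minor_polynomial (adjacency R e) theta k pk) :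
  (k_independence_number e k)%:R <= \tr (horner_mx (adjacency R e) pk) /\
  \tr (horner_mx (adjacency R e) pk) = \sum_i (m i)%:R * pk.[theta i].
Proof.
have [sym _] := he; have [pk_size pk_top pk_ge0] := hpk.1.
have [decr eig mE] := hspec.
have theta_inj : injective theta.
  move=> i j tij; case: (ltngtP i j) => [ij|ji|/val_inj//].
    by have := decr i j ij; rewrite tij ltxx.
  by have := decr j i ji; rewrite tij ltxx.
have symA := adjacency_sym R _ _ sym.
have [lam [charA trA psdA]] := symmetric_spectrum _ _ _ symA.
have lam_theta i : exists j, lam i = theta j.
  apply/eig; rewrite eigenvalue_root_char charA.
  rewrite -(big_map lam xpredT (fun a => 'X - a%:P)) root_prod_XsubC.
  by apply/map_f; rewrite mem_index_enum.
have pk_lam i : 0 <= pk.[lam i].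
  have [j ->] := lam_theta i.
  by have [->|/pk_ge0//] := eqVneq j ord0; rewrite pk_top ler01.
split; last first.
  rewrite trA (sum_over_roots _ _ _ _ theta (horner pk)) //.
  by apply: eq_bigr => j _; rewrite mE charA.
rewrite /k_independence_number; apply: (big_ind (fun N => N%:R <= _)).
- by rewrite trA sumr_ge0.
- by move=> a b ? ?; rewrite /maxn; case: ifP.
move=> S indS.
have [k0|k_gt0] := posnP k.
  have pk1 : pk = 1%:P.
    rewrite k0 in pk_size; rewrite (size1_polyC pk_size) in pk_top *.
    by rewrite hornerC in pk_top; rewrite pk_top.
  by rewrite pk1 horner_mx_C mxtrace1 ler_nat -[leqRHS]card_ord max_card.
have reg : regular e.
  case: (ltngtP k 1) => [|k_gt1|/hreg//]; first by rewrite ltnNge k_gt0.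
  exact: walk_regular_regular sym hwr k_gt1.
apply: (zero_block_trace_bound _ _ _ (horner_mx (adjacency R e) pk ord0 ord0)).
- by rewrite trmx_horner symA.
- rewrite (horner_eigenvector _ _ _ _ (theta ord0)) ?pk_top ?scale1r //.
  exact: regular_largest_eigenvalue sym hspec reg.
- exact: psdA.
- by move=> i; apply: horner_diag_const hwr pk_size.
move=> u v uS vS uv; apply: horner_far pk_size.
by have /forall_inP/(_ u uS)/forall_inP/(_ v vS)/implyP := indS; apply.
Qed.
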